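(* Let $p\in(1,\infty)$, $s\in\{0,1,2,\dots\}$, let $C_{(s)}\in[1,\infty)$ be a constant such that $|P^{(s)}_Q(f)(x)|\le C_{(s)}\fint_Q|f|$ for every cube $Q$ of $\mathbb{R}^n$, every $f\in L^1(Q)$ and every $x\in Q$, let $\theta\in(0,2^{-n}C_{(s)}^{-1})$, let $Q_0$ be a cube of $\mathbb{R}^n$, and let $f\in\widetilde{JN}_{(p,1,s)_0}(Q_0)$. Then, for any $\lambda\in(0,\infty)$ with $\lambda\ge\frac1\theta\fint_{Q_0}|f-P^{(s)}_{Q_0}(|f|)|$, $$\left|\left\{x\in Q_0:\mathcal{M}^{(\mathrm d)}_{Q_0}\left(f-P^{(s)}_{Q_0}(|f|)\right)(x)>\lambda\right\}\right|\le\frac{1+C_{(s)}}{1-2^n\theta C_{(s)}}\,\frac{\|f\|_{\widetilde{JN}_{(p,1,s)_0}(Q_0)}}{\lambda}\left|\left\{x\in Q_0:\mathcal{M}^{(\mathrm d)}_{Q_0}\left(f-P^{(s)}_{Q_0}(|f|)\right)(x)>\theta\lambda\right\}\right|^{1/p'},$$ where $p'$ is the conjugate index of $p$, i.e. $1/p+1/p'=1$.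
   Context: A cube in $\mathbb{R}^n$ has finite positive edge length and edges parallel to the coordinate axes; it need not be open or closed. Functions are real-valued. $\fint_Q f:=\frac1{|Q|}\int_Q f$. For $s\in\{0,1,2,\dots\}$, a cube $Q$ and $f$ integrable on $Q$, $P^{(s)}_Q(f)$ is the unique polynomial of degree at most $s$ such that $\int_Q[f(x)-P^{(s)}_Q(f)(x)]x^\gamma\,dx=0$ for every multi-index $\gamma$ with $|\gamma|\le s$. It is well known that a constant $C_{(s)}$ as in the claim, independent of $f$ and $Q$, exists. $\widetilde{JN}_{(p,1,s)_0}(Q_0)$ is the set of all $f\in L^1(Q_0)$ with $$\|f\|_{\widetilde{JN}_{(p,1,s)_0}(Q_0)}:=\sup\left\{\sum_i|Q_i|\left[\fint_{Q_i}\left|f-P^{(s)}_{Q_i}(|f|)\right|\right]^p\right\}^{1/p}<\infty,$$ the supremum being over all collections $\{Q_i\}_i$ of cubes contained in $Q_0$ with pairwise disjoint interiors. For a cube $Q$ with edge length $l(Q)$ and lower-left vertex $(a_1,\dots,a_n)$, and $\ell\in\{0,1,2,\dots\}$, $\mathcal{D}^{(\ell)}_Q$ is the family of the $2^{\ell n}$ dyadic subcubes $\prod_{i=1}^n[a_i+k_i2^{-\ell}l(Q),\,a_i+(k_i+1)2^{-\ell}l(Q)]$ with $k_i\in\{0,\dots,2^\ell-1\}$ (boundaries of cubes, being null sets, play no role), and $\mathcal{D}_Q:=\bigcup_{\ell\ge0}\mathcal{D}^{(\ell)}_Q$. The dyadic maximal operator is $\mathcal{M}^{(\mathrm d)}_Q(g)(x):=\sup\fint_{R}|g|$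 for $g\in L^1(Q)$ and $x\in Q$, the supremum being over all $R\in\mathcal{D}_Q$ containing $x$. *)

(* Defs.v *)
From HB Require Import structures.
From mathcomp Require Import all_boot all_order all_algebra.
(* The notations of mpoly clash with those of the analysis library; mpoly is
   loaded first because both libraries use the names Measure and isMeasure. *)
From mathcomp Require Import -(notations) mpoly.
From mathcomp Require Import all_classical all_reals all_analysis.

Set Implicit Arguments.
Unset Strict Implicit.
Unset Printing Implicit Defensive.
Import Order.TTheory GRing.Theory Num.Theory.
Import numFieldNormedType.Exports.

Local Open Scope classical_set_scope.
Local Open Scope ring_scope.

(* Lebesgue measure on R^n is the completion of the n-fold product of the
   one-dimensional Lebesgue measure.  The product is built by recursion on n
   on the Borel sets of n.-tuple R. *)
Section tuple_lebesgue.
Context {R : realType}.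
Local Notation tup n := (n.-tuple (measurableTypeR R)).

Definition tcons n (xy : measurableTypeR R * tup n) : tup n.+1 :=
  [tuple of xy.1 :: xy.2].

Lemma measurable_tcons n : measurable_fun [set: measurableTypeR R * tup n] (@tcons n).
Proof. by apply: measurable_cons; [exact: measurable_fst|exact: measurable_snd]. Qed.

Section succ.
Variables (n : nat) (m : {sigma_finite_measure set (tup n) -> \bar R}).

Definition lebesgue_succ : set (tup n.+1) -> \bar R :=
  pushforward (@lebesgue_measure R \x m)%E (@tcons n).

Let succ0 : lebesgue_succ set0 = 0%E.
Proof. by rewrite /lebesgue_succ /pushforward preimage_set0 measure0. Qed.

Let succ_ge0 A : (0 <= lebesgue_succ A)%E.
Proof. by apply: integral_ge0 => x _; exact: measure_ge0. Qed.

Let mpre A : measurable A -> measurable (@tcons n @^-1` A).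
Proof. by move=> mA; rewrite -[X in measurable X]setTI; exact: measurable_tcons. Qed.

Let succ_sigma_additive : semi_sigma_additive lebesgue_succ.
Proof.
move=> F mF tF mUF; rewrite /lebesgue_succ /pushforward preimage_bigcup.
apply: measure_semi_sigma_additive; first by move=> i; exact: mpre.
- apply/trivIsetP => /= i j _ _ ij; rewrite -preimage_setI.
  by move/trivIsetP : tF => /(_ _ _ _ _ ij) ->//; rewrite preimage_set0.
- by rewrite -preimage_bigcup; exact: mpre.
Qed.

HB.instance Definition _ := isMeasure.Build _ _ _ lebesgue_succ
  succ0 succ_ge0 succ_sigma_additive.

Let succ_sigma_finite : sigma_finite setT lebesgue_succ.
Proof.
have /sigma_finiteP[F [TF ndF Foo]] := sigma_finiteT (@lebesgue_measure R).
have /sigma_finiteP[G [TG ndG Goo]] := sigma_finiteT m.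
pose u (t : tup n.+1) : measurableTypeR R * tup n :=
  (tnth t ord0, [tuple of behead t]).
have uK : cancel u (@tcons n).
  by move=> t; rewrite [RHS]tuple_eta; exact/val_inj.
have Ku : cancel (@tcons n) u.
  by move=> [x t]; rewrite /u /tcons tnth0 /=; congr pair; exact/val_inj.
have mu : measurable_fun [set: tup n.+1] u.
  by apply: measurable_fun_pair; [exact: measurable_tnth|exact: measurable_behead].
exists (fun k => u @^-1` (F k `*` G k)).
  rewrite -preimage_bigcup -[LHS](preimage_setT u); congr (_ @^-1` _).
  rewrite -setXTT TF TG predeqE => -[x y]; split; last first.
    by move=> [k _ []/= ? ?]; split; exists k.
  move=> [/= [k _ Fkx] [l _ Gly]]; exists (maxn k l) => //; split.
  - by move: x Fkx; exact/subsetPset/ndF/leq_maxl.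
  - by move: y Gly; exact/subsetPset/ndG/leq_maxr.
move=> k; have [mF Fk] := Foo k; have [mG Gk] := Goo k; split.
  by rewrite -[X in measurable X]setTI; apply: mu => //; exact: measurableX.
rewrite /lebesgue_succ /pushforward -comp_preimage.
rewrite (_ : u \o @tcons n = id); last by rewrite funeqE.
rewrite preimage_id product_measure1E//.
by rewrite lte_mul_pinfty// ge0_fin_numE.
Qed.

HB.instance Definition _ := Measure_isSigmaFinite.Build _ _ _ lebesgue_succ
  succ_sigma_finite.

End succ.

Fixpoint tuple_lebesgue n : {sigma_finite_measure set (tup n) -> \bar R} :=
  if n is n'.+1 then lebesgue_succ (tuple_lebesgue n')
  else @dirac _ (tup 0) [tuple] R.

End tuple_lebesgue.

Section lebesgue_rV.
Context {R : realType}.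

Definition row_of_tuple n (t : n.-tuple R) : 'rV[R]_n := \row_i tnth t i.

Definition lebesgue_outer n (A : set 'rV[R]_n) : \bar R :=
  (@tuple_lebesgue R n)^*%mu (@row_of_tuple n @^-1` A).

Section outer.
Variable n : nat.

Let outer0 : @lebesgue_outer n set0 = 0%E.
Proof. by rewrite /lebesgue_outer preimage_set0 outer_measure0. Qed.

Let outer_ge0 A : (0 <= @lebesgue_outer n A)%E.
Proof. exact: outer_measure_ge0. Qed.

Let le_outer : {homo @lebesgue_outer n : A B / A `<=` B >-> (A <= B)%E}.
Proof. by move=> A B AB; apply: le_outer_measure => t; exact: AB. Qed.

Let outer_sigma_subadditive : sigma_subadditive (@lebesgue_outer n).
Proof.
by move=> F; rewrite /lebesgue_outer preimage_bigcup;
  exact: outer_measure_sigma_subadditive.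
Qed.

HB.instance Definition _ := isOuterMeasure.Build R 'rV[R]_n (@lebesgue_outer n)
  outer0 outer_ge0 le_outer outer_sigma_subadditive.
End outer.

(* The domain carries the sigma-algebra of all Lebesgue measurable sets. *)
Definition lebesgue_rV n :
  set (caratheodory_type (@lebesgue_outer n)) -> \bar R := @lebesgue_outer n.

HB.instance Definition _ n := isMeasure.Build _ _ _ (@lebesgue_rV n)
  (@caratheodory_measure0 R 'rV[R]_n (@lebesgue_outer n))
  (@caratheodory_measure_ge0 R 'rV[R]_n (@lebesgue_outer n))
  (@caratheodory_measure_sigma_additive R 'rV[R]_n (@lebesgue_outer n)).

End lebesgue_rV.

(* A product of n bounded intervals of the same positive length; each of its
   2n faces may or may not be included. *)
Record cube (R : realType) (n : nat) := Cube {
  corner : 'rV[R]_n ;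
  side : R ;
  side_gt0 : 0 < side ;
  lclosed : 'I_n -> bool ;
  rclosed : 'I_n -> bool }.

HB.instance Definition _ (R : realType) n := gen_eqMixin (cube R n).
HB.instance Definition _ (R : realType) n := gen_choiceMixin (cube R n).

Definition cube_set (R : realType) n (Q : cube R n) : set 'rV[R]_n :=
  [set x | forall i, x ord0 i \in
    Interval (BSide (lclosed Q i) (corner Q ord0 i))
             (BSide (~~ rclosed Q i) (corner Q ord0 i + side Q))].
Coercion cube_set : cube >-> set.

Section John_Nirenberg.
Context {R : realType} {n : nat}.
Local Notation leb := (@lebesgue_rV R n).
Implicit Types (Q : cube R n) (f g : 'rV[R]_n -> R) (p : R) (s l : nat).

Definition integrable_on Q f := leb.-integrable Q (EFin \o f).

Definition average Q f : \bar R :=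
  ((leb Q)^-1 * \int[leb]_(x in Q) (f x)%:E)%E.

Definition peval (P : mpoly n R) (x : 'rV[R]_n) : R := meval (x ord0) P.

(* mmeasure mdeg P is 1 + the total degree of P, and 0 if P = 0. *)
Definition is_projection s Q f (P : mpoly n R) : Prop :=
  (mmeasure mdeg P <= s.+1)%N /\
  forall gamma : multinom n, (mdeg gamma <= s)%N ->
    (\int[leb]_(x in Q)
       ((f x - peval P x) * \prod_(i < n) x ord0 i ^+ gamma i)%:E = 0)%E.

(* The unique P with is_projection s Q f P when f is integrable on Q. *)
Definition projection s Q f : mpoly n R :=
  xget 0 [set P | is_projection s Q f P].

Definition deviation s Q f (x : 'rV[R]_n) : R :=
  f x - peval (projection s Q (fun y => `|f y|)) x.

Definition JN_norm p s Q0 f : \bar R :=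
  ereal_sup [set
    ((\esum_(Q in S)
        leb Q * average Q (fun x => `|deviation s Q f x|)%R `^ p) `^ p^-1)%E
    | S in [set S : set (cube R n) |
        (forall Q, S Q -> Q `<=` Q0) /\
        trivIset S (fun Q => interior (Q : set 'rV[R]_n))]].

Definition in_JN p s Q0 f : Prop :=
  integrable_on Q0 f /\ (JN_norm p s Q0 f < +oo)%E.

Lemma dyadic_side_gt0 Q l : 0 < side Q / 2 ^+ l.
Proof. by rewrite divr_gt0 ?side_gt0 ?exprn_gt0. Qed.

Definition dyadic_cube Q l (k : 'I_n -> 'I_(2 ^ l)) : cube R n :=
  @Cube R n (\row_i (corner Q ord0 i + (k i)%:R * (side Q / 2 ^+ l)))
    (side Q / 2 ^+ l) (dyadic_side_gt0 Q l) (fun=> true) (fun=> true).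

Definition dyadic_level Q l : set (cube R n) := range (@dyadic_cube Q l).

Definition dyadic Q : set (cube R n) := \bigcup_l dyadic_level Q l.

Definition dyadic_maximal Q g (x : 'rV[R]_n) : \bar R :=
  ereal_sup [set average D (fun y => `|g y|)%R
            | D in [set D | dyadic Q D /\ (D : set _) x]].

End John_Nirenberg.

(* Main.v *)
(* Write g = f - P_{Q0}(|f|) and consider the maximal dyadic cubes Q_j on which
   the average of |g| exceeds theta*lambda, and the maximal ones R on which it
   exceeds lambda; each R lies in some Q_j.  With h_j = P_{Q_j}(g), maximality
   and the bound on projections give |h_j| <= 2^n C theta lambda on Q_j, so that
     (1 - 2^n theta C) lambda * sum_{R in Q_j} |R| <= int_{Q_j} |g - h_j|.
   A projection fixes polynomials of degree at most s, hence, with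
   q = P_{Q_j}(|f|), g - h_j = (f - q) - P_{Q_j}(f - q), whose integral is at
   most (1 + C) int_{Q_j} |f - q|.  Summing over j, Hoelder's inequality
   concludes.  Open dyadic cubes are used throughout: they are contained in Q0
   whichever faces Q0 has, and they differ from the closed ones by null sets.
   Existence of projections comes from the Gram matrix of the monomials: a
   vector of its kernel gives a polynomial vanishing almost everywhere on Q. *)
Require Import Defs.
From mathcomp Require Import all_boot all_order all_algebra.
From mathcomp Require Import -(notations) mpoly.
From mathcomp Require Import all_classical all_reals all_analysis.
From mathcomp Require Import measurable_realfun zify lra ring.

Set Implicit Arguments.
Unset Strict Implicit.
Unset Printing Implicit Defensive.
Import Order.TTheory GRing.Theory Num.Theory.
Import numFieldNormedType.Exports.
Local Open Scope classical_set_scope.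
Local Open Scope ring_scope.

(** * Measurability and volume of cubes; nullity of their faces *)

Section LebesgueBoxes.
Context {R : realType}.
Local Notation tup n := (n.-tuple (measurableTypeR R)).
Local Notation leb n := (@lebesgue_rV R n).

(** The pullback is Borel, hence Caratheodory measurable for the outer measure of [tuple_lebesgue];
    preimages commute with intersection and complement, so the splitting identity passes to
    [lebesgue_outer]. *)
Lemma measurable_row n (A : set 'rV[R]_n) :
  measurable (@row_of_tuple R n @^-1` A : set (tup n)) ->
  measurable (A : set (caratheodory_type (@lebesgue_outer R n))).
Proof.
move=> mA; apply: le_caratheodory_measurable => X.
have /= := sub_caratheodory (@tuple_lebesgue R n) (sub_gen_smallest mA) (@row_of_tuple R n @^-1` X).
by rewrite /= /lebesgue_outer preimage_setI preimage_setI preimage_setC => <-.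
Qed.

Lemma lebesgue_rVE n (A : set 'rV[R]_n) :
  measurable (@row_of_tuple R n @^-1` A : set (tup n)) ->
  leb n A = tuple_lebesgue n (@row_of_tuple R n @^-1` A).
Proof. by move=> mA; rewrite /lebesgue_rV /lebesgue_outer /= measurable_mu_extE. Qed.

Lemma measurable_tuple_box n (I : 'I_n -> set R) :
  (forall i, measurable (I i)) ->
  measurable ([set t | forall i, I i (tnth t i)] : set (tup n)).
Proof.
move=> mI.
rewrite (_ : [set t | _] = \bigcap_(i in [set: 'I_n]) ((@tnth n R)^~ i @^-1` I i)).
  apply: fin_bigcap_measurable; first exact: finite_finset.
  move=> i _.
  by rewrite -[X in measurable X]setTI; apply: measurable_tnth => //; exact: mI.
by apply/seteqP; split=> [t h i _|t h i]; exact: h.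
Qed.

(** Induction on [n]: pulled back along [tcons], a box is the product of its first side with a box
    of one dimension less. *)
Lemma tuple_lebesgue_box n (I : 'I_n -> set R) :
  (forall i, measurable (I i)) ->
  tuple_lebesgue n [set t | forall i, I i (tnth t i)] =
  (\prod_(i < n) lebesgue_measure (I i))%E.
Proof.
elim: n I => [|n IH] I mI.
  rewrite big_ord0 /= diracE mem_set // => -[]//.
rewrite /= /lebesgue_succ /pushforward.
rewrite (_ : _ @^-1` _ = I ord0 `*`
    [set t : tup n | forall i, I (lift ord0 i) (tnth t i)]).
  rewrite product_measure1E; last 2 first.
  - exact: mI.
  - exact: (measurable_tuple_box (fun i => mI (lift ord0 i))).
  rewrite big_ord_recl -(IH (fun i => I (lift ord0 i))) // => i; exact: mI.
apply/seteqP; split=> -[x t] /=.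
  move=> h; split; first by have := h ord0.
  by move=> i; have := h (lift ord0 i); rewrite /tcons /= tnthS.
move=> [h0 h1] i; rewrite /tcons.
case: (unliftP ord0 i) => [j ->|->]; first by rewrite tnthS; exact: h1.
exact: h0.
Qed.

Definition cube_itv n (Q : cube R n) (i : 'I_n) : interval R :=
  Interval (BSide (lclosed Q i) (corner Q ord0 i))
           (BSide (~~ rclosed Q i) (corner Q ord0 i + side Q)).

Lemma preimage_cube n (Q : cube R n) :
  @row_of_tuple R n @^-1` Q =
  [set t | forall i, [set` cube_itv Q i] (tnth t i)].
Proof.
by apply/seteqP; split=> t /= h i; have := h i; rewrite /row_of_tuple mxE.
Qed.

Lemma measurable_coord n (i : 'I_n) :
  measurable_fun [set: caratheodory_type (@lebesgue_outer R n)]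
    (fun x : 'rV[R]_n => x ord0 i).
Proof.
move=> _ B mB; rewrite setTI; apply: measurable_row.
rewrite (_ : _ @^-1` _ = (@tnth n R)^~ i @^-1` B); last first.
  by apply/seteqP; split=> t /=; rewrite /row_of_tuple mxE.
by rewrite -[X in measurable X]setTI; apply: measurable_tnth.
Qed.

Lemma measurable_cube n (Q : cube R n) :
  measurable (Q : set (caratheodory_type (@lebesgue_outer R n))).
Proof.
apply: measurable_row; rewrite preimage_cube.
exact: (measurable_tuple_box (fun i => measurable_itv (cube_itv Q i))).
Qed.

Lemma lebesgue_cube n (Q : cube R n) : leb n Q = (side Q ^+ n)%:E.
Proof.
rewrite lebesgue_rVE preimage_cube; last first.
  exact: (measurable_tuple_box (fun i => measurable_itv (cube_itv Q i))).
rewrite (tuple_lebesgue_box (fun i => measurable_itv (cube_itv Q i))).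
under eq_bigr => i _.
  rewrite lebesgue_measure_itv /= lte_fin ltrDl side_gt0 -EFinB addrC addKr; over.
by rewrite prodEFin prodr_const card_ord.
Qed.

Lemma lebesgue_rV_null n (N A : set 'rV[R]_n) :
  measurable (N : set (caratheodory_type (@lebesgue_outer R n))) ->
  leb n N = 0%E -> A `<=` N ->
  measurable (A : set (caratheodory_type (@lebesgue_outer R n))).
Proof.
move=> mN N0 AN; have := @measure_is_complete_caratheodory R _ (@lebesgue_outer R n).
by apply; exists N; split.
Qed.

Definition interior_cube n (Q : cube R n) : cube R n :=
  Cube (corner Q) (side_gt0 Q) (fun=> false) (fun=> false).

Definition closure_cube n (Q : cube R n) : cube R n :=
  Cube (corner Q) (side_gt0 Q) (fun=> true) (fun=> true).

Lemma interior_cubeP n (Q : cube R n) x : (interior_cube Q : set _) x <->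
  forall i, corner Q ord0 i < x ord0 i < corner Q ord0 i + side Q.
Proof. by split=> h i; have := h i; rewrite in_itv. Qed.

Lemma closure_cubeP n (Q : cube R n) x : (closure_cube Q : set _) x <->
  forall i, corner Q ord0 i <= x ord0 i <= corner Q ord0 i + side Q.
Proof. by split=> h i; have := h i; rewrite in_itv. Qed.

Lemma interior_cube_sub n (Q : cube R n) : interior_cube Q `<=` Q.
Proof.
move=> x /interior_cubeP h i; have /andP[h1 h2] := h i.
rewrite itv_boundlr; apply/andP; split.
  by case: (lclosed Q i); rewrite bnd_simp // ltW.
by case: (rclosed Q i); rewrite bnd_simp // ltW.
Qed.

Lemma sub_closure_cube n (Q : cube R n) : Q `<=` closure_cube Q.
Proof.
move=> x h; apply/closure_cubeP => i; have := h i.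
rewrite itv_boundlr => /andP[h1 h2]; apply/andP; split.
  by move: h1; case: (lclosed Q i); rewrite bnd_simp // => /ltW.
by move: h2; case: (rclosed Q i); rewrite bnd_simp // => /ltW.
Qed.

(** Both volumes are [side Q ^+ n]. This is what lets open, closed and arbitrary cubes be
    exchanged. *)
Lemma cubeD_null n (Q Q' : cube R n) : side Q' = side Q -> Q' `<=` Q ->
  leb n (Q `\` Q') = 0%E.
Proof.
move=> sQ QQ'; have foo : (leb n Q < +oo)%E by rewrite lebesgue_cube ltry.
have := measureD (measurable_cube Q) (measurable_cube Q') foo.
rewrite setIidr // => ->.
transitivity ((side Q ^+ n)%:E - (side Q' ^+ n)%:E)%E; last by rewrite sQ subee.
by congr (_ - _)%E; exact: lebesgue_cube.
Qed.

End LebesgueBoxes.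

(** * Polynomials on cubes and existence of projections *)

Lemma measurable_monomial_sum d (T : measurableType d) (R : realType)
    (I J : eqType) (r : seq I) (t : seq J) (c : I -> R) (e : I -> J -> nat)
    (X : J -> T -> R) :
  (forall j, measurable_fun setT (X j)) ->
  measurable_fun setT (fun x => \sum_(i <- r) c i * \prod_(j <- t) X j x ^+ e i j).
Proof.
move=> mX; apply: measurable_sum => i; apply: measurable_funM => //.
by apply: measurable_prod => j _; exact: measurable_funX.
Qed.

Section PolynomialProjection.
Context {R : realType} {n : nat}.
Local Notation leb := (@lebesgue_rV R n).
Local Notation lebm := (@lebesgue_rV R n :
  {measure set (caratheodory_type (@lebesgue_outer R n)) -> \bar R}).
Local Notation monom m := (mpolyX R m).
Implicit Types (Q : cube R n) (f g u v : 'rV[R]_n -> R) (P : mpoly n R) (s : nat).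

Lemma peval_monom (m : multinom n) (x : 'rV[R]_n) :
  peval (monom m) x = \prod_(i < n) x ord0 i ^+ m i.
Proof. exact: mevalX. Qed.

Lemma peval_sum (I : Type) (r : seq I) (c : I -> R) (F : I -> mpoly n R) x :
  peval (\sum_(i <- r) c i *: F i) x = \sum_(i <- r) c i * peval (F i) x.
Proof.
rewrite /peval raddf_sum; apply: eq_bigr => i _; exact: mevalZ.
Qed.

Lemma pevalB P P' x : peval (P - P') x = peval P x - peval P' x.
Proof. exact: mevalB. Qed.

Lemma measurable_peval P (D : set 'rV[R]_n) :
  measurable_fun (D : set (caratheodory_type (@lebesgue_outer R n))) (peval P).
Proof.
have -> : peval P = fun x => \sum_(m <- msupp P) mcoeff m P *
    \prod_(i <- index_enum 'I_n) x ord0 i ^+ m i.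
  by apply/funext => x; rewrite /peval mevalE.
have mE := measurable_monomial_sum (msupp P) (index_enum 'I_n) (fun m => mcoeff m P)
  (fun (m : multinom n) (i : 'I_n) => m i) (@measurable_coord R n).
exact: measurable_funTS mE.
Qed.

Lemma peval_bounded Q P : exists M, forall x, (Q : set _) x -> `|peval P x| <= M.
Proof.
(* One bound for all coordinates on the closure of [Q]. *)
pose B := \sum_(i < n) `|corner Q ord0 i| + side Q.
have hB x : (Q : set _) x -> forall i, `|x ord0 i| <= B.
  move=> /sub_closure_cube/closure_cubeP h i; have /andP[h1 h2] := h i.
  have c1 : `|corner Q ord0 i| <= \sum_(j < n) `|corner Q ord0 j|.
    by rewrite (bigD1 i) //= lerDl sumr_ge0.
  have s0 := side_gt0 Q.
  move: c1; rewrite /B; set c := corner Q ord0 i in h1 h2 *.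
  have := ler_norm c; have := ler_norm (- c); rewrite normrN => k1 k2 c1.
  by rewrite ler_norml; apply/andP; split; lra.
exists (\sum_(m <- msupp P) `|mcoeff m P| * \prod_(i < n) B ^+ m i) => x Qx.
rewrite /peval mevalE; apply: le_trans (ler_norm_sum _ _ _) _.
apply: ler_sum => m _; rewrite normrM ler_wpM2l // normr_prod.
apply: ler_prod => i _; rewrite normr_ge0 /= normrX lerXn2r ?nnegrE //.
  by apply: le_trans (normr_ge0 (x ord0 i)) _; exact: hB.
exact: hB.
Qed.

Lemma integrable_mul_peval Q u P : integrable_on Q u ->
  integrable_on Q (fun x => u x * peval P x).
Proof.
move=> iu; have [M hM] := peval_bounded Q P.
have := @integrableMl _ _ _ leb Q (measurable_cube Q) _ (peval P) iu.
rewrite /integrable_on; apply; first exact: measurable_peval.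
exists M; split; first exact: num_real.
by move=> N MN x Qx; apply: le_trans (hM _ Qx) (ltW MN).
Qed.

Lemma integrable_peval Q P : integrable_on Q (peval P).
Proof.
have [M hM] := peval_bounded Q P.
apply: (@measurable_bounded_integrable _ _ _ leb _ _ (measurable_cube Q)).
- by have := lebesgue_cube Q => /= ->; rewrite ltry.
- exact: measurable_peval.
exists M; split; first exact: num_real.
by move=> N MN x Qx; apply: le_trans (hM _ Qx) (ltW MN).
Qed.

Lemma integrable_onB Q u v : integrable_on Q u -> integrable_on Q v ->
  integrable_on Q (fun x => u x - v x).
Proof. by move=> iu iv; exact: (integrableB (measurable_cube Q) iu iv). Qed.

Lemma integrable_onD Q u v : integrable_on Q u -> integrable_on Q v ->
  integrable_on Q (fun x => u x + v x).
Proof. by move=> iu iv; exact: (integrableD (measurable_cube Q) iu iv). Qed.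

Lemma integrable_on_norm Q u : integrable_on Q u ->
  integrable_on Q (fun x => `|u x|).
Proof. exact: integrable_norm. Qed.

Lemma integrable_on_sub (Q Q' : cube R n) u : Q' `<=` Q ->
  integrable_on Q u -> integrable_on Q' u.
Proof.
by move=> s; apply: integrableS => //; exact: measurable_cube.
Qed.

Lemma average_normE Q u : integrable_on Q u ->
  average Q (fun x => `|u x|) =
  ((side Q ^+ n)^-1 * \int[leb]_(x in Q) `|u x|)%:E.
Proof.
move=> iu; rewrite /average.
have -> := lebesgue_cube Q.
rewrite inver gt_eqF ?exprn_gt0 ?side_gt0 // EFinM; congr (_ * _)%E.
rewrite fineK //.
exact: (integrable_fin_num (measurable_cube Q) (integrable_on_norm iu)).
Qed.

Lemma Rintegral_peval_sum Q u (I : Type) (r : seq I) (c : I -> R)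
    (F : I -> mpoly n R) : integrable_on Q u ->
  \int[leb]_(x in Q) (u x * peval (\sum_(i <- r) c i *: F i) x) =
  \sum_(i <- r) c i * \int[leb]_(x in Q) (u x * peval (F i) x).
Proof.
move=> iu; under eq_Rintegral => x _.
  rewrite peval_sum mulr_sumr; under eq_bigr do rewrite mulrCA.
  over.
have mQ := measurable_cube Q.
have ii i : leb.-integrable Q (EFin \o (fun x => c i * (u x * peval (F i) x))).
  apply: (eq_integrable mQ (fun x => (c i)%:E * (u x * peval (F i) x)%:E)%E) => //.
  exact: (integrableZl mQ (c i) (integrable_mul_peval (F i) iu)).
elim: r => [|i r IH].
  rewrite big_nil; under eq_Rintegral do rewrite big_nil.
  by rewrite Rintegral_cst // mul0r.
rewrite big_cons -IH; under eq_Rintegral do rewrite big_cons.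
rewrite RintegralD //; last first.
  have -> : EFin \o (fun x => \sum_(i0 <- r) c i0 * (u x * peval (F i0) x)) =
     (fun x => \sum_(i0 <- r) (c i0 * (u x * peval (F i0) x))%:E)%E.
    by apply/funext => x /=; rewrite sumEFin.
  exact: (integrable_sum mQ r (P := xpredT) (fun i _ => ii i)).
by congr (_ + _); rewrite RintegralZl //; exact: integrable_mul_peval.
Qed.

(** Integrability makes the extended-real integrals of the definition finite, so passing to real
    integrals, where an infinite value would read as 0, loses nothing. *)
Lemma is_projectionP s Q f P : integrable_on Q f ->
  is_projection s Q f P <->
  (mmeasure mdeg P <= s.+1)%N /\
  forall m : multinom n, (mdeg m <= s)%N ->
    \int[leb]_(x in Q) ((f x - peval P x) * peval (monom m) x) = 0.
Proof.
move=> if_; rewrite /is_projection.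
have ifP m : leb.-integrable Q
    (EFin \o (fun x => (f x - peval P x) * peval (monom m) x)).
  by apply: integrable_mul_peval; apply: integrable_onB => //; exact: integrable_peval.
have fnum m := integrable_fin_num (measurable_cube Q) (ifP m).
split=> -[sP h]; split=> // m /h {}h.
  rewrite /Rintegral.
  under eq_integral do rewrite peval_monom.
  by rewrite h.
have := fineK (fnum m); rewrite [X in X%:E](_ : _ = 0); last exact: h.
under eq_integral do rewrite /= peval_monom.
by move=> <-.
Qed.

Lemma orthogonal_poly s Q u P : integrable_on Q u -> (mmeasure mdeg P <= s.+1)%N ->
  (forall m : multinom n, (mdeg m <= s)%N ->
    \int[leb]_(x in Q) (u x * peval (monom m) x) = 0) ->
  \int[leb]_(x in Q) (u x * peval P x) = 0.
Proof.
move=> iu sP h; rewrite [P]mpolyE Rintegral_peval_sum // big_seq big1 // => m mP.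
by rewrite h ?mulr0 // -ltnS; apply: leq_trans sP; exact: mmeasure_mnm_lt.
Qed.

(** Testing [P] against itself makes the integral of its square vanish. This is the form in which
    uniqueness of projections is used. *)
Lemma orthogonal_poly_ae0 s Q P : (mmeasure mdeg P <= s.+1)%N ->
  (forall m : multinom n, (mdeg m <= s)%N ->
    \int[leb]_(x in Q) (peval P x * peval (monom m) x) = 0) ->
  {ae lebm, forall x, (Q : set _) x -> peval P x = 0}.
Proof.
move=> sP h; have mQ := measurable_cube Q.
have iP := integrable_peval Q P.
have := orthogonal_poly iP sP h.
have iPP := integrable_mul_peval P iP.
have fn := integrable_fin_num mQ iPP.
rewrite /Rintegral => h0.
have {}h0 : (\int[leb]_(x in Q) `|(peval P x * peval P x)%:E| = 0)%E.
  under eq_integral => x _ do rewrite /= -expr2 ger0_norm ?sqr_ge0 // expr2.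
  by rewrite -(fineK fn) /= [X in X%:E]h0.
have mPP := measurable_int _ iPP.
have /(ae_eq_integral_abs leb mQ mPP) := h0.
apply: filterS => x /[apply] /= -[/eqP].
by rewrite mulf_eq0 orbb => /eqP.
Qed.

Lemma ae_imply (A B : 'rV[R]_n -> Prop) : (forall x, A x -> B x) ->
  {ae lebm, forall x, A x} -> {ae lebm, forall x, B x}.
Proof.
by move=> AB; apply: (@negligibleS _ _ _ lebm) => x /=; apply: contra_not; exact: AB.
Qed.

Lemma ae_and (A B : 'rV[R]_n -> Prop) :
  {ae lebm, forall x, A x} -> {ae lebm, forall x, B x} ->
  {ae lebm, forall x, A x /\ B x}.
Proof.
move=> a b; have := @negligibleU _ _ _ lebm _ _ a b.
by apply: (@negligibleS _ _ _ lebm) => x /= /not_andP.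
Qed.

Lemma eq_ae_Rintegral Q u v : integrable_on Q u -> integrable_on Q v ->
  {ae lebm, forall x, (Q : set _) x -> u x = v x} ->
  \int[leb]_(x in Q) u x = \int[leb]_(x in Q) v x.
Proof.
move=> iu iv uv; congr fine.
apply: (@ae_eq_integral _ _ _ leb _ (EFin \o v) (EFin \o u) (measurable_cube Q)
  (measurable_int _ iu) (measurable_int _ iv)).
by move: uv; apply: ae_imply => x /[apply] /= ->.
Qed.

(** The coefficients solve a linear system with Gram matrix [G] and right-hand side [b]. It is
    solvable because each kernel vector of [G] annihilates [b]: its polynomial vanishes almost
    everywhere on [Q], hence so does its product with [f]. *)
Lemma projection_exists s Q f : integrable_on Q f ->
  is_projection s Q f (projection s Q f).
Proof.
move=> if_; rewrite /projection.
suff h : exists P, is_projection s Q f P.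
  exact: (@xgetPex _ 0 [set P | is_projection s Q f P] h).
(* The finite type of multi-indices of degree below [s.+1]; [e] enumerates it by matrix indices. *)
pose I : finType := bmultinom n s.+1.
pose e (i : 'I_#|I|) : multinom n := bmnm (enum_val i).
have eP (m : multinom n) : (mdeg m <= s)%N -> exists i, e i = m.
  rewrite -ltnS => hm; exists (enum_rank (BMultinom hm)).
  by rewrite /e enum_rankK.
have esize i : (mdeg (e i) <= s)%N by rewrite -ltnS bmdeg.
pose poly (c : 'I_#|I| -> R) : mpoly n R := \sum_i c i *: monom (e i).
have polysize c : (mmeasure mdeg (poly c) <= s.+1)%N.
  apply: leq_trans (mmeasure_sum _ _ _ _) _; apply/bigmax_leqP => i _.
  by apply: leq_trans (mmeasureZ_le _ _ _) _; rewrite mmeasureX ltnS esize.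
pose G : 'M[R]_#|I| := \matrix_(i, j)
  \int[leb]_(x in Q) (peval (monom (e i)) x * peval (monom (e j)) x).
pose b : 'rV[R]_#|I| := \row_j \int[leb]_(x in Q) (f x * peval (monom (e j)) x).
have int_poly u c : integrable_on Q u ->
    \int[leb]_(x in Q) (u x * peval (poly c) x) =
    \sum_i c i * \int[leb]_(x in Q) (u x * peval (monom (e i)) x).
  exact: Rintegral_peval_sum.
have : (b <= G)%MS.
  (* By [submxE], the row [b] has to kill each column [c] of [cokermx G]; these columns are killed
     by [G]. *)
  rewrite submxE; apply/eqP/rowP => k; rewrite !mxE.
  pose c i := cokermx G i k.
  have c0 : {ae lebm, forall x, (Q : set _) x -> peval (poly c) x = 0}.
    apply: (@orthogonal_poly_ae0 s) => // m /eP[i <-].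
    under eq_Rintegral do rewrite mulrC.
    rewrite int_poly; last exact: integrable_peval.
    have /matrixP/(_ i k) := mulmx_coker G; rewrite !mxE => G0; rewrite -[RHS]G0.
    by apply: eq_bigr => j _; rewrite mulrC; congr (_ * _); rewrite mxE.
  transitivity (\int[leb]_(x in Q) (f x * peval (poly c) x)).
    by rewrite int_poly //; apply: eq_bigr => j _; rewrite mulrC; congr (_ * _); rewrite mxE.
  rewrite (@eq_ae_Rintegral Q _ (fun x => 0)).
  - by rewrite Rintegral_cst ?mul0r //; exact: measurable_cube.
  - exact: integrable_mul_peval.
  - exact: (integrable0 leb Q).
  by move: c0; apply: ae_imply => x /[apply] ->; rewrite mulr0.
case/submxP => D bD; exists (poly (D ord0)).
apply/is_projectionP => //; split=> // m /eP[j <-].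
under eq_Rintegral do rewrite mulrBl.
rewrite RintegralB; first last.
- by apply: integrable_mul_peval; exact: integrable_peval.
- exact: integrable_mul_peval.
- exact: measurable_cube.
apply/eqP; rewrite subr_eq0; apply/eqP.
have /rowP/(_ j) := bD; rewrite !mxE => ->.
under [in RHS]eq_Rintegral do rewrite mulrC.
rewrite int_poly; last exact: integrable_peval.
apply: eq_bigr => i _; rewrite mxE; congr (_ * _).
by apply: eq_Rintegral => x _; rewrite mulrC.
Qed.

Lemma projection_size s Q f : integrable_on Q f ->
  (mmeasure mdeg (projection s Q f) <= s.+1)%N.
Proof. by move=> /(projection_exists s)[]. Qed.

(** The difference [p1 - P - p2] of the two sides is the difference of two residuals orthogonal to
    the monomials of degree at most [s], and is itself of degree at most [s]. *)
Lemma projection_addpoly s Q f P : integrable_on Q f ->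
  (mmeasure mdeg P <= s.+1)%N ->
  {ae lebm, forall x, (Q : set _) x ->
     peval (projection s Q (fun y => f y - peval P y)) x =
     peval (projection s Q f) x - peval P x}.
Proof.
move=> if_ sP.
have ig : integrable_on Q (fun y => f y - peval P y).
  by apply: integrable_onB => //; exact: integrable_peval.
have /(is_projectionP _ _ if_)[s1 h1] := projection_exists s if_.
have /(is_projectionP _ _ ig)[s2 h2] := projection_exists s ig.
set p1 := projection s Q f in s1 h1 *.
set p2 := projection s Q _ in s2 h2 *.
suff : {ae lebm, forall x, (Q : set _) x -> peval (p1 - P - p2) x = 0}.
  apply: ae_imply => x /[apply]; rewrite !pevalB => /eqP.
  by rewrite subr_eq0 => /eqP.
have sizeB (p q : mpoly n R) : (mmeasure mdeg p <= s.+1)%N ->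
    (mmeasure mdeg q <= s.+1)%N -> (mmeasure mdeg (p - q) <= s.+1)%N.
  move=> hp hq; apply: leq_trans (mmeasureD_le _ _ _) _.
  by rewrite mmeasureN geq_max hp hq.
apply: (@orthogonal_poly_ae0 s); first exact: (sizeB _ _ (sizeB _ _ s1 sP) s2).
move=> m hm.
transitivity (\int[leb]_(x in Q)
    ((f x - peval P x - peval p2 x) * peval (monom m) x -
     (f x - peval p1 x) * peval (monom m) x)).
  by apply: eq_Rintegral => x _; rewrite !pevalB; ring.
rewrite RintegralB; first last.
- apply: integrable_mul_peval; apply: integrable_onB => //.
  exact: integrable_peval.
- apply: integrable_mul_peval; apply: integrable_onB => //.
  exact: integrable_peval.
- exact: measurable_cube.
by rewrite h1 // h2 // subrr.
Qed.

End PolynomialProjection.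

(** * Hoelder's inequality for weighted finite sums *)

Lemma finite_hoelder (R : realType) (I : eqType) (r : seq I) (v a : I -> R) (p q : R) :
  0 < p -> 0 < q -> p^-1 + q^-1 = 1 ->
  (forall i, 0 <= v i) -> (forall i, 0 <= a i) ->
  \sum_(i <- r) v i * a i <=
  (\sum_(i <- r) v i * a i `^ p) `^ p^-1 * (\sum_(i <- r) v i) `^ q^-1.
Proof.
move=> p0 q0 pq v0 a0.
set X := \sum_(i <- r) v i * a i `^ p; set V := \sum_(i <- r) v i.
have X0 : 0 <= X by apply: sumr_ge0 => i _; rewrite mulr_ge0 ?powR_ge0.
have V0 : 0 <= V by apply: sumr_ge0 => i _.
have rhs0 : 0 <= X `^ p^-1 * V `^ q^-1 by rewrite mulr_ge0 ?powR_ge0.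
(* In the degenerate case every term on the left is 0: either [v i = 0], or [V != 0], hence [X = 0]
   and [a i = 0]. *)
have [XV|XV] := eqVneq (X * V) 0.
  rewrite big_seq big1 // => i ir.
  have [->|vi] := eqVneq (v i) 0; first by rewrite mul0r.
  have le1 (F : I -> R) : (forall i, 0 <= F i) -> F i <= \sum_(j <- r) F j.
    by move=> F0; rewrite (big_rem i ir) /= lerDl sumr_ge0.
  have Vgt : V != 0.
    rewrite gt_eqF // (lt_le_trans _ (le1 v v0)) //.
    by rewrite lt_neqAle eq_sym vi v0.
  move/eqP: XV; rewrite mulf_eq0 (negbTE Vgt) orbF => /eqP XE.
  have := le1 (fun j => v j * a j `^ p) (fun j => mulr_ge0 (v0 j) (powR_ge0 _ _)).
  rewrite -/X XE => h.
  have /eqP : v i * a i `^ p = 0.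
    by apply/eqP; rewrite eq_le h mulr_ge0 ?powR_ge0.
  by rewrite mulf_eq0 (negbTE vi) /= powR_eq0 => /andP[/eqP -> _]; rewrite mulr0.
have Xgt : 0 < X by rewrite lt_neqAle X0 eq_sym andbT; apply: contraNneq XV => ->; rewrite mul0r.
have Vgt : 0 < V by rewrite lt_neqAle V0 eq_sym andbT; apply: contraNneq XV => ->; rewrite mulr0.
set A := X `^ p^-1; set B := V `^ q^-1.
have A0 : 0 < A by exact: powR_gt0.
have B0 : 0 < B by exact: powR_gt0.
have AX : A `^ p = X by rewrite /A -powRrM mulVf ?gt_eqF // powRr1.
have BV : B `^ q = V by rewrite /B -powRrM mulVf ?gt_eqF // powRr1.
have AB0 : 0 < A * B by rewrite mulr_gt0.
rewrite -[leRHS]mulr1 -ler_pdivrMl // mulr_sumr.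
apply: (@le_trans _ _ (\sum_(i <- r) (p^-1 * (v i * a i `^ p) / X + q^-1 * v i / V))).
  apply: ler_sum => i _.
  have A0' : 0 <= A^-1 by rewrite invr_ge0 ltW.
  have B0' : 0 <= B^-1 by rewrite invr_ge0 ltW.
  (* Young's inequality for [a i / A] and [1 / B], then weighted by [v i]. As [A] to the [p] is [X]
     and [B] to the [q] is [V], the sum over [i] is at most [p^-1 + q^-1 = 1]. *)
  have := conjugate_powR (mulr_ge0 (a0 i) A0') B0' p0 q0 pq.
  rewrite powRM //.
  have inv_pow (x t : R) : 0 < x -> x^-1 `^ t = (x `^ t)^-1.
    by move=> x0; rewrite -(powR_inv1 (ltW x0)) -powRrM mulN1r powRN.
  rewrite !inv_pow // AX BV => h.
  have := ler_wpM2l (v0 i) h.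
  rewrite (_ : (A * B)^-1 * (v i * a i) = v i * (a i / A / B)); last first.
    by rewrite invfM; ring.
  by move=> /le_trans; apply; rewrite le_eqVlt; apply/orP; left; apply/eqP; ring.
rewrite big_split /= -!mulr_suml -!mulr_sumr -/X -/V.
by rewrite !mulfK ?gt_eqF // pq.
Qed.

(** * Integer indices of dyadic cubes and their ancestors *)

Section DyadicIndices.
Context {R : realType} {n : nat}.
Local Notation idx := (nat * {ffun 'I_n -> nat})%type.
Implicit Types (i j : idx) (Q : cube R n).

(** An index is a level with integer coordinates; naturals instead of bounded ordinals give one
    countable type for all levels, and validity restores the bound. *)
Definition dyadic_valid i := [forall t, i.2 t < 2 ^ i.1]%N.

(** For [m <= i.1], dropping the last [i.1 - m] binary digits of each coordinate gives the cube of
    level [m] around cube [i]. *)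
Definition ancestor (m : nat) i : idx := (m, [ffun t => i.2 t %/ 2 ^ (i.1 - m)]%N).

Definition open_dyadic Q i : cube R n :=
  Cube (\row_t (corner Q ord0 t + (i.2 t)%:R * (side Q / 2 ^+ i.1)))
    (dyadic_side_gt0 Q i.1) (fun=> false) (fun=> false).

Lemma open_dyadicP Q i x : (open_dyadic Q i : set _) x <->
  forall t, corner Q ord0 t + (i.2 t)%:R * (side Q / 2 ^+ i.1) < x ord0 t <
            corner Q ord0 t + (i.2 t).+1%:R * (side Q / 2 ^+ i.1).
Proof.
have e t : corner Q ord0 t + (i.2 t)%:R * (side Q / 2 ^+ i.1) + side Q / 2 ^+ i.1 =
    corner Q ord0 t + (i.2 t).+1%:R * (side Q / 2 ^+ i.1).
  by rewrite -[(i.2 t).+1%:R]natr1 mulrDl mul1r addrA.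
by split=> h t; have := h t; rewrite in_itv /= mxE e.
Qed.

Lemma ancestor_id i : ancestor i.1 i = i.
Proof.
case: i => l k; rewrite /ancestor /= subnn; congr pair.
by apply/ffunP => t; rewrite ffunE expn0 divn1.
Qed.

Lemma ancestor_ancestor m m' i : (m' <= m)%N -> (m <= i.1)%N ->
  ancestor m' (ancestor m i) = ancestor m' i.
Proof.
move=> h1 h2; rewrite /ancestor /=; congr pair; apply/ffunP => t.
rewrite !ffunE -divnMA -expnD; congr (_ %/ 2 ^ _)%N; lia.
Qed.

Lemma ancestor_valid m i : (m <= i.1)%N -> dyadic_valid i ->
  dyadic_valid (ancestor m i).
Proof.
move=> mi /forallP h; apply/forallP => t /=; rewrite ffunE ltn_divLR ?expn_gt0 //.
by rewrite -expnD subnKC.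
Qed.

(** Measured in the finer edge length, the coarser one is [2 ^ d], and both bounds are those of
    Euclidean division by [2 ^ d]. *)
Lemma ancestor_bounds Q m i (t : 'I_n) : (m <= i.1)%N ->
  ((ancestor m i).2 t)%:R * (side Q / 2 ^+ m) <= (i.2 t)%:R * (side Q / 2 ^+ i.1) /\
  (i.2 t).+1%:R * (side Q / 2 ^+ i.1) <=
    ((ancestor m i).2 t).+1%:R * (side Q / 2 ^+ m).
Proof.
move=> mi; rewrite /= ffunE; set d := (i.1 - m)%N.
rewrite (_ : side Q / 2 ^+ m = (2 ^ d)%:R * (side Q / 2 ^+ i.1)); last first.
  rewrite -(subnK mi) -/d exprD natrX; field.
  by rewrite !expf_neq0 // pnatr_eq0.
have := dyadic_side_gt0 Q i.1; move: (side Q / 2 ^+ i.1) => h /ltW h0.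
rewrite !mulrA -!natrM !ler_wpM2r ?ler_nat ?leq_divM //.
by rewrite ltn_ceil // expn_gt0.
Qed.

Lemma open_dyadic_ancestor Q m i : (m <= i.1)%N ->
  open_dyadic Q i `<=` open_dyadic Q (ancestor m i).
Proof.
move=> mi x /open_dyadicP h; apply/open_dyadicP => t.
have /andP[h1 h2] := h t; have [b1 b2] := ancestor_bounds Q t mi.
by rewrite (le_lt_trans _ h1) ?(lt_le_trans h2) // lerD2l.
Qed.

Lemma closure_dyadicP Q i x : (closure_cube (open_dyadic Q i) : set _) x <->
  forall t, corner Q ord0 t + (i.2 t)%:R * (side Q / 2 ^+ i.1) <= x ord0 t <=
            corner Q ord0 t + (i.2 t).+1%:R * (side Q / 2 ^+ i.1).
Proof.
have e t : corner Q ord0 t + (i.2 t)%:R * (side Q / 2 ^+ i.1) + side Q / 2 ^+ i.1 =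
    corner Q ord0 t + (i.2 t).+1%:R * (side Q / 2 ^+ i.1).
  by rewrite -[(i.2 t).+1%:R]natr1 mulrDl mul1r addrA.
by split=> h t; have := h t; rewrite in_itv /= mxE e.
Qed.

Lemma closure_dyadic_ancestor Q m i : (m <= i.1)%N ->
  closure_cube (open_dyadic Q i) `<=` closure_cube (open_dyadic Q (ancestor m i)).
Proof.
move=> mi x /closure_dyadicP h; apply/closure_dyadicP => t.
have /andP[h1 h2] := h t; have [b1 b2] := ancestor_bounds Q t mi.
by rewrite (le_trans _ h1) ?(le_trans h2) // lerD2l.
Qed.

Lemma open_dyadic_level_inj Q i j x : i.1 = j.1 ->
  (open_dyadic Q i : set _) x -> (open_dyadic Q j : set _) x -> i = j.
Proof.
case: i j => [l k] [_ k'] /= <- /open_dyadicP hi /open_dyadicP hj.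
congr pair; apply/ffunP => t.
have /= /andP[i1 i2] := hi t; have /= /andP[j1 j2] := hj t.
have h0 : 0 < side Q / 2 ^+ l by exact: dyadic_side_gt0.
have := lt_trans i1 j2; have := lt_trans j1 i2.
rewrite !ltrD2l !ltr_pM2r // !ltr_nat; lia.
Qed.

Lemma open_dyadic_sub Q i : dyadic_valid i -> open_dyadic Q i `<=` Q.
Proof.
move=> /forallP h x /(open_dyadic_ancestor (leq0n i.1)) /open_dyadicP hx.
apply: interior_cube_sub; apply/interior_cubeP => t.
have /= := hx t; rewrite ffunE subn0 divn_small // expr0 divr1.
by rewrite mul0r mul1r addr0.
Qed.

Lemma eq_corner (c c' : 'rV[R]_n) (r : R) (r0 : 0 < r) (a b : 'I_n -> bool) :
  c = c' -> Cube c r0 a b = Cube c' r0 a b.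
Proof. by move=> ->. Qed.

Lemma dyadic_cubeE Q l (k : 'I_n -> 'I_(2 ^ l)) :
  exists2 i, dyadic_valid i & dyadic_cube Q k = closure_cube (open_dyadic Q i).
Proof.
exists (l, [ffun t => k t : nat]); first by apply/forallP => t /=; rewrite ffunE.
rewrite /dyadic_cube /closure_cube /=; apply: eq_corner.
by apply/rowP => t; rewrite !mxE ffunE.
Qed.

Lemma dyadic_closure_cube Q i : dyadic_valid i ->
  dyadic Q (closure_cube (open_dyadic Q i)).
Proof.
move=> /forallP h; exists i.1 => //; exists (fun t => Ordinal (h t)) => //.
Qed.

(** * Stopping-time selection of maximal dyadic cubes *)

Section Selection.
Variables (Q : cube R n) (A : idx -> R).

(** The ordinals below [i.1] are exactly the levels of the strict ancestors of [i], so the last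
    clause is maximality, in boolean form. *)
Definition selected (t : R) i :=
  [&& dyadic_valid i, t < A i & [forall m : 'I_i.1, A (ancestor m i) <= t]].

(** The least level at which an ancestor exceeds [t] works, because ancestors of an ancestor of [i]
    are ancestors of [i]. *)
Lemma selected_ancestor t i : dyadic_valid i -> t < A i ->
  exists2 m, (m <= i.1)%N & selected t (ancestor m i).
Proof.
move=> vi ti.
have ex : exists m, (m <= i.1)%N && (t < A (ancestor m i)).
  by exists i.1; rewrite leqnn ancestor_id.
case: (ex_minnP ex) => m /andP[mi tm] min; exists m => //.
apply/and3P; split=> //; first exact: ancestor_valid.
apply/forallP => -[m' m'm] /=; rewrite leNgt; apply/negP => h.
have := min m'; rewrite ancestor_ancestor // in h; last exact: ltnW.
by rewrite h (leq_trans (ltnW m'm) mi) => /(_ isT); rewrite leqNgt m'm.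
Qed.

(** A common point makes the coarser index an ancestor of the finer one; a strict ancestor would
    contradict the maximality of the finer. *)
Lemma selected_disjoint t i j x : selected t i -> selected t j ->
  (open_dyadic Q i : set _) x -> (open_dyadic Q j : set _) x -> i = j.
Proof.
wlog ij : i j / (i.1 <= j.1)%N.
  move=> h; case/orP: (leq_total i.1 j.1) => [|ji]; first exact: h.
  by move=> si sj xi xj; apply/esym; exact: h.
move=> /and3P[_ ti _] /and3P[_ _ /forallP sj] xi xj.
have ia : i = ancestor i.1 j.
  by apply: (@open_dyadic_level_inj Q _ _ x) => //; exact: open_dyadic_ancestor xj.
move: ij; rewrite leq_eqVlt => /predU1P[e|lt]; first by rewrite ia e ancestor_id.
by have := sj (Ordinal lt); rewrite /= -ia leNgt ti.
Qed.

End Selection.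

End DyadicIndices.

(** * Integral estimates over disjoint families of cubes *)

Lemma measure_disjoint_sum d (T : measurableType d) (R : realType)
    (mu : {measure set T -> \bar R}) (I : eqType) (r : seq I) (F : I -> set T) :
  (forall i, measurable (F i)) -> uniq r -> trivIset [set` r] F ->
  mu (\big[setU/set0]_(i <- r) F i) = (\sum_(i <- r) mu (F i))%E.
Proof.
move=> mF ur tF.
have mU : measurable (\big[setU/set0]_(i <- r) F i) by exact: bigsetU_measurable.
have := @ge0_integral_bigsetU _ _ _ mu _ F (cst 1%E) r mF ur tF.
rewrite /= integral_cst // mul1e => -> //.
by apply: eq_bigr => i _; rewrite integral_cst // mul1e.
Qed.

Section LocalEstimates.
Context {R : realType} {n : nat}.
Local Notation leb := (@lebesgue_rV R n).
Local Notation lebm := (@lebesgue_rV R n :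
  {measure set (caratheodory_type (@lebesgue_outer R n)) -> \bar R}).
Implicit Types (Q : cube R n) (f g u w : 'rV[R]_n -> R) (P : mpoly n R) (s : nat).

(** On the null difference of the two cubes any function is measurable, by completeness of the
    measure. *)
Lemma measurable_fun_cube_null Q Q' u : side Q' = side Q -> Q' `<=` Q ->
  integrable_on Q' u ->
  measurable_fun (Q : set (caratheodory_type (@lebesgue_outer R n))) (EFin \o u).
Proof.
move=> sQ QQ' iu.
have mN : measurable (Q `\` Q' : set (caratheodory_type (@lebesgue_outer R n))).
  by apply: measurableD; exact: measurable_cube.
have -> : (Q : set _) = Q' `|` (Q `\` Q') by rewrite setDUK.
apply/(measurable_funU _ (measurable_cube Q') mN); split.
  exact: (measurable_int _ iu).
by move=> _ B mB; apply: (lebesgue_rV_null mN (cubeD_null sQ QQ')); exact: subIsetl.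
Qed.

Lemma average_cube_null Q Q' u : side Q' = side Q -> Q' `<=` Q ->
  integrable_on Q' u ->
  average Q (fun x => `|u x|) = average Q' (fun x => `|u x|).
Proof.
move=> sQ QQ' iu; rewrite /average.
congr (_ * _)%E.
  by have -> := lebesgue_cube Q; have -> := lebesgue_cube Q'; rewrite sQ.
have mN : measurable (Q `\` Q' : set (caratheodory_type (@lebesgue_outer R n))).
  by apply: measurableD; exact: measurable_cube.
have mu := measurable_fun_cube_null sQ QQ' (integrable_on_norm iu).
have := @ge0_negligible_integral _ _ _ lebm Q (Q `\` Q') _ mN (measurable_cube Q) mu.
rewrite setDD setIidr // => -> //; last exact: cubeD_null.
by move=> x _; rewrite lee_fin.
Qed.

Lemma cube_nonempty Q : exists x, (Q : set _) x.
Proof.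
exists (\row_i (corner Q ord0 i + side Q / 2)); apply: interior_cube_sub.
apply/interior_cubeP => i; rewrite mxE; have := side_gt0 Q => s0.
by apply/andP; split; lra.
Qed.

Section DisjointCubes.
Variables (I : eqType) (r : seq I) (c : I -> cube R n).
Hypothesis uniq_r : uniq r.
Hypothesis disjoint_c : forall i j x, i \in r -> j \in r ->
  (c i : set _) x -> (c j : set _) x -> i = j.

Lemma trivIset_cubes : trivIset [set` r] (fun i => c i : set _).
Proof. by move=> i j /= ir jr [x [xi xj]]; exact: (disjoint_c ir jr xi xj). Qed.

Lemma uniq_cubes : uniq (map c r).
Proof.
rewrite map_inj_in_uniq // => i j ir jr e.
have [x xi] := cube_nonempty (c i).
by apply: (disjoint_c ir jr xi); rewrite -e.
Qed.

Lemma sum_Rintegral_cubes Q u : integrable_on Q u ->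
  (forall i, i \in r -> c i `<=` Q) ->
  \sum_(i <- r) \int[leb]_(x in c i) `|u x| <= \int[leb]_(x in Q) `|u x|.
Proof.
move=> iu cQ; have mQ := measurable_cube Q; have inu := integrable_on_norm iu.
have fn i : i \in r ->
    (\int[leb]_(x in c i) (`|u x|)%:E)%E = (\int[leb]_(x in c i) `|u x|)%:E.
  move=> ir; rewrite fineK //.
  exact: (integrable_fin_num (measurable_cube _) (integrable_on_sub (cQ i ir) inu)).
rewrite -lee_fin -sumEFin big_seq.
under eq_bigr => i ir do rewrite -fn //.
rewrite -big_seq [leRHS]fineK; last exact: (integrable_fin_num mQ inu).
have mu := measurable_int _ inu.
have UQ : \big[setU/set0]_(i <- r) (c i : set _) `<=` Q.
  rewrite big_seq; elim/big_ind: _ => [//|A B hA hB x [/hA|/hB] //|i ir].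
  exact: cQ.
have mU : measurable (\big[setU/set0]_(i <- r)
    (c i : set (caratheodory_type (@lebesgue_outer R n)))).
  by apply: bigsetU_measurable => i _; exact: measurable_cube.
have u0 (x : 'rV[R]_n) : (0 <= (`|u x|)%:E)%E by rewrite lee_fin.
rewrite -(ge0_integral_bigsetU lebm (fun i => measurable_cube (c i)) uniq_r
  trivIset_cubes (measurable_funS mQ UQ mu) (fun x _ => u0 x)).
exact: (ge0_subset_integral lebm mU mQ mu (fun x _ => u0 x) UQ).
Qed.

(** Additivity is applied to the measurable union of the cubes; monotonicity of the outer measure
    then reaches an arbitrary set [E], such as a superlevel set. *)
Lemma sum_volume_cubes (E : set 'rV[R]_n) : (forall i, i \in r -> c i `<=` E) ->
  ((\sum_(i <- r) side (c i) ^+ n)%:E <= leb E)%E.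
Proof.
move=> cE; apply: (@le_trans _ _ (leb (\big[setU/set0]_(i <- r) (c i : set _)))).
  have -> := measure_disjoint_sum lebm (fun i => measurable_cube (c i)) uniq_r
    trivIset_cubes.
  rewrite -sumEFin le_eqVlt; apply/orP; left; apply/eqP.
  by apply: eq_bigr => i _; rewrite -lebesgue_cube.
apply: (le_outer_measure (@lebesgue_outer R n)).
rewrite big_seq; elim/big_ind: _ => [//|A B hA hB x [/hA|/hB] //|i ir].
exact: cE.
Qed.

(** On each small cube, [lambda] times the volume is at most the integral of [|g|], hence of
    [|g - h| + B]; subtract the [B] term and sum. *)
Lemma good_lambda_cube Q g h lambda B : integrable_on Q g -> integrable_on Q h ->
  (forall x, (Q : set _) x -> `|h x| <= B) ->
  (forall i, i \in r -> c i `<=` Q) ->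
  (forall i, i \in r -> lambda * side (c i) ^+ n <= \int[leb]_(x in c i) `|g x|) ->
  (lambda - B) * (\sum_(i <- r) side (c i) ^+ n) <=
  \int[leb]_(x in Q) `|g x - h x|.
Proof.
move=> ig ih hB cQ gl.
have igh := integrable_onB ig ih.
apply: le_trans (sum_Rintegral_cubes igh cQ).
rewrite mulr_sumr big_seq [leRHS]big_seq; apply: ler_sum => i ir.
have mc := measurable_cube (c i).
have ic := integrable_on_sub (cQ i ir) (integrable_on_norm igh).
rewrite mulrBl lerBlDr; apply: le_trans (gl i ir) _.
have iB : integrable_on (c i) (fun=> B).
  have := integrable_peval (c i) (mpolyC n B).
  by congr (integrable_on _ _); apply/funext => x; rewrite /peval mevalC.
have cst : \int[leb]_(x in c i) B = B * side (c i) ^+ n.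
  by rewrite Rintegral_cst //; congr (_ * _); exact: (congr1 fine (lebesgue_cube _)).
rewrite -cst -RintegralD //.
apply: le_Rintegral => //.
- exact: integrable_on_sub (cQ i ir) (integrable_on_norm ig).
- exact: integrable_onD ic iB.
move=> x cx; have := hB x (cQ i ir x cx).
have := ler_normD (g x - h x) (h x); rewrite subrK => h1 h2.
by apply: le_trans h1 _; rewrite lerD2l.
Qed.

(** The cubes form an admissible family. Being nonempty and disjoint, they are distinct for distinct
    indices, so the sum over the set of cubes equals the sum over the list. *)
Lemma JN_norm_ge p s Q0 f : integrable_on Q0 f ->
  (forall i, i \in r -> c i `<=` Q0) ->
  (((\sum_(i <- r) side (c i) ^+ n * ((side (c i) ^+ n)^-1 *
      \int[leb]_(x in c i) `|deviation s (c i) f x|) `^ p) `^ p^-1)%:E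
   <= JN_norm p s Q0 f)%E.
Proof.
move=> if_ cQ; apply: ereal_sup_ubound.
exists [set` map c r]; first split.
- by move=> _ /= /mapP[i ir ->]; exact: cQ.
- move=> _ _ /= /mapP[i ir ->] /mapP[j jr ->] [x [xi xj]].
  by congr c; exact: (disjoint_c ir jr (interior_subset xi) (interior_subset xj)).
rewrite esum_fset; last 2 first.
- exact: finite_seq.
- by move=> Q _; rewrite mule_ge0 ?poweR_ge0 // ?measure_ge0.
rewrite -fsbig_seq ?uniq_cubes // big_map -poweR_EFin -sumEFin; congr (_ `^ _)%E.
rewrite big_seq [RHS]big_seq; apply: eq_bigr => i ir.
have ifc := integrable_on_sub (cQ i ir) if_.
have -> := lebesgue_cube (c i).
rewrite average_normE ?poweR_EFin ?EFinM //.
by apply: integrable_onB => //; exact: integrable_peval.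
Qed.

End DisjointCubes.

(** Subtracting from [f - P] its own projection leaves a function that does not depend on [P] almost
    everywhere, so [P] may be replaced by [P']. The triangle inequality and the bound on projections
    then give the terms 1 and [C]. *)
Lemma oscillation_projection s Q f (C : R) P P' : 0 <= C -> integrable_on Q f ->
  (forall g, integrable_on Q g -> forall x, (Q : set _) x ->
    (`|peval (projection s Q g) x|%:E <= C%:E * average Q (fun y => `|g y|)%R)%E) ->
  (mmeasure mdeg P <= s.+1)%N -> (mmeasure mdeg P' <= s.+1)%N ->
  \int[leb]_(x in Q) `|f x - peval P x -
      peval (projection s Q (fun y => f y - peval P y)) x| <=
  (1 + C) * \int[leb]_(x in Q) `|f x - peval P' x|.
Proof.
move=> C0 if_ hC sP sP'.
have ip (q : mpoly n R) := integrable_peval Q q.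
have ifP q := integrable_onB if_ (ip q).
set h := projection s Q (fun y => f y - peval P y).
set h' := projection s Q (fun y => f y - peval P' y).
rewrite (@eq_ae_Rintegral _ _ Q _ (fun x => `|f x - peval P' x - peval h' x|)).
- set c := C * ((side Q ^+ n)^-1 * \int[leb]_(x in Q) `|f x - peval P' x|).
  have hc x : (Q : set _) x -> `|peval h' x| <= c.
    by move=> Qx; have := hC _ (ifP P') x Qx; rewrite average_normE // -EFinM lee_fin.
  have ic : integrable_on Q (fun=> c).
    have := ip (mpolyC n c).
    by congr (integrable_on _ _); apply/funext => x; rewrite /peval mevalC.
  have cst : \int[leb]_(x in Q) c = C * \int[leb]_(x in Q) `|f x - peval P' x|.
    rewrite Rintegral_cst; last exact: measurable_cube.
    transitivity (c * side Q ^+ n); last first.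
      by rewrite /c; field; rewrite expf_neq0 // gt_eqF // side_gt0.
    congr (_ * _); exact: (congr1 fine (lebesgue_cube _)).
  rewrite mulrDl mul1r -cst -RintegralD //; last 2 first.
  - exact: measurable_cube.
  - exact: integrable_on_norm.
  apply: le_Rintegral.
  + exact: measurable_cube.
  + by apply: integrable_on_norm; exact: integrable_onB.
  + by apply: integrable_onD => //; exact: integrable_on_norm.
  move=> x Qx; apply: le_trans (ler_normB _ _) _.
  by rewrite lerD2l; exact: hc.
- by apply: integrable_on_norm; exact: integrable_onB.
- by apply: integrable_on_norm; exact: integrable_onB.
have e1 := projection_addpoly if_ sP.
have e2 := projection_addpoly if_ sP'.
have := ae_and e1 e2; apply: ae_imply => x [{}e1 {}e2] Qx.
rewrite /h /h' e1 // e2 //; congr (`| _ |); ring.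
Qed.

End LocalEstimates.

(** * Dyadic averages of the deviation and its superlevel sets *)

Section GoodLambda.
Context {R : realType} {n : nat}.
Variables (s : nat) (Q0 : cube R n) (f : 'rV[R]_n -> R).
Hypothesis if_ : integrable_on Q0 f.
Local Notation leb := (@lebesgue_rV R n).
Local Notation lebm := (@lebesgue_rV R n :
  {measure set (caratheodory_type (@lebesgue_outer R n)) -> \bar R}).
Local Notation idx := (nat * {ffun 'I_n -> nat})%type.
Local Notation g := (deviation s Q0 f).
Local Notation D i := (open_dyadic Q0 i).
Local Notation vol i := (side (open_dyadic Q0 i) ^+ n).

Lemma integrable_deviation : integrable_on Q0 g.
Proof. by apply: integrable_onB => //; exact: integrable_peval. Qed.

Definition dyadic_average (i : idx) : R :=
  (vol i)^-1 * \int[leb]_(x in D i) `|g x|.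
Local Notation A := dyadic_average.

Definition superlevel (t : R) : set 'rV[R]_n :=
  [set x | (Q0 : set _) x /\ (t%:E < dyadic_maximal Q0 g x)%E].

Lemma vol_gt0 i : 0 < vol i. Proof. by rewrite exprn_gt0 // side_gt0. Qed.

Lemma integrable_deviation_dyadic i : dyadic_valid i -> integrable_on (D i) g.
Proof.
by move=> vi; apply: integrable_on_sub integrable_deviation; exact: open_dyadic_sub.
Qed.

Lemma average_closure_dyadic i : dyadic_valid i ->
  average (closure_cube (D i)) (fun x => `|g x|) = (A i)%:E.
Proof.
move=> vi; have ig := integrable_deviation_dyadic vi.
rewrite -[RHS](average_normE ig).
by apply: average_cube_null => //; exact: sub_closure_cube.
Qed.

Lemma average_root : average Q0 (fun x => `|g x|) = (A (0%N, [ffun=> 0%N]))%:E.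
Proof.
have v0 : dyadic_valid ((0%N, [ffun=> 0%N]) : idx).
  by apply/forallP => t /=; rewrite ffunE.
have ig := integrable_deviation_dyadic v0.
rewrite -[RHS](average_normE ig).
apply: average_cube_null => //; last exact: open_dyadic_sub.
by rewrite /= expr0 divr1.
Qed.

Lemma dyadic_sub_superlevel t i : dyadic_valid i -> t < A i -> D i `<=` superlevel t.
Proof.
move=> vi ti x xi; split; first exact: open_dyadic_sub xi.
apply: (@lt_le_trans _ _ (A i)%:E); first by rewrite lte_fin.
apply: ereal_sup_ubound; exists (closure_cube (D i)).
  by split; [exact: dyadic_closure_cube|exact: sub_closure_cube].
exact: average_closure_dyadic.
Qed.

(** A cube witnessing the supremum at [x] is replaced by its maximal ancestor; closures are taken
    since [x] may lie on a face. *)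
Lemma superlevel_cover t x : superlevel t x ->
  exists2 i, selected A t i & (closure_cube (D i) : set _) x.
Proof.
move=> [xQ /ereal_sup_gt[_ [Q [[l _ [k _ <-]] xk] <-]]].
have [i vi e] := dyadic_cubeE Q0 k; rewrite e in xk *.
rewrite average_closure_dyadic // lte_fin => ti.
have [m mi sm] := selected_ancestor vi ti; exists (ancestor m i) => //.
exact: closure_dyadic_ancestor xk.
Qed.

(** The root is excluded by its average, so [i] has a parent. Maximality bounds the average over the
    parent by [t], and the parent has [2 ^+ n] times the volume. *)
Lemma selected_average_le t i : A (0%N, [ffun=> 0%N]) <= t -> selected A t i ->
  A i <= 2 ^+ n * t.
Proof.
move=> t0 /and3P[vi ti /forallP hi].
case E : i.1 => [|l].
  (* At level 0 validity forces all coordinates to be 0, so [i] is the root. *)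
  move: ti; rewrite ltNge => /negP; case.
  rewrite (_ : i = (0%N, [ffun=> 0%N])) //.
  rewrite [LHS]surjective_pairing E; congr pair; apply/ffunP => j; rewrite ffunE.
  by have := forallP vi j; rewrite E expn0 ltnS leqn0 => /eqP.
have li : (l < i.1)%N by rewrite E.
have := hi (Ordinal li) => /= hl.
apply: (le_trans _ (ler_wpM2l _ hl)); last by rewrite exprn_ge0.
have vp := ancestor_valid (ltnW li) vi.
have sideE : side (D (ancestor l i)) = 2 * side (D i).
  rewrite /= E exprS; field.
  by rewrite expf_neq0 // pnatr_eq0.
have volE : vol (ancestor l i) = 2 ^+ n * vol i by rewrite sideE; exact: exprMn.
rewrite /A volE.
have two_n (v I : R) : 0 < v -> 2 ^+ n * ((2 ^+ n * v)^-1 * I) = v^-1 * I.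
  by move=> v0; field; rewrite gt_eqF //= expf_neq0 // pnatr_eq0.
rewrite two_n ?vol_gt0 //.
rewrite ler_wpM2l ?invr_ge0 ?(ltW (vol_gt0 i)) //.
(* Monotonicity of the integral, as the one-cube case of the sum over disjoint cubes. *)
have := @sum_Rintegral_cubes _ _ _ [:: i] (fun j => D j) isT _
  (D (ancestor l i)) g (integrable_deviation_dyadic vp).
rewrite big_seq1; apply.
  by move=> j k x; rewrite !inE => /eqP -> /eqP ->.
by move=> j; rewrite inE => /eqP ->; apply: open_dyadic_ancestor; exact: ltnW.
Qed.

(** * The good-lambda estimate for fixed constants *)

Section Constants.
Variables (p p' C theta lambda : R).
Hypothesis p_gt1 : 1 < p.
Hypothesis conj : p^-1 + p'^-1 = 1.
Hypothesis C_ge1 : 1 <= C.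
Hypothesis projection_le : forall (Q : cube R n) (u : 'rV[R]_n -> R),
  integrable_on Q u -> forall x : 'rV[R]_n, (Q : set _) x ->
  (`|peval (projection s Q u) x|%:E <= C%:E * average Q (fun y => `|u y|)%R)%E.
Hypothesis theta_lt : theta < (2 ^+ n)^-1 * C^-1.
Hypothesis JN_fin : (JN_norm p s Q0 f < +oo)%E.
Hypothesis lambda_gt0 : 0 < lambda.
Hypothesis root_le : A (0%N, [ffun=> 0%N]) <= theta * lambda.

Lemma kappa_gt0 : 0 < 1 - 2 ^+ n * theta * C.
Proof.
have C0 : 0 < C by exact: lt_le_trans C_ge1.
have : 2 ^+ n * theta * C < 2 ^+ n * ((2 ^+ n)^-1 * C^-1) * C.
  by rewrite ltr_pM2r // ltr_pM2l // exprn_gt0.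
by rewrite mulrA mulfV ?mul1r ?mulVf ?subr_gt0 ?gt_eqF // exprn_gt0.
Qed.

Lemma theta_lambda_le : theta * lambda <= lambda.
Proof.
rewrite ger_pMl //; apply: le_trans (ltW theta_lt) _.
rewrite -invfM invf_le1; last by rewrite mulr_gt0 ?exprn_gt0 // (lt_le_trans _ C_ge1).
by rewrite mulr_ege1 // exprn_ege1 // ler1n.
Qed.

Lemma dual_gt0 : 0 < p'.
Proof.
have : 0 < p'^-1.
  have -> : p'^-1 = 1 - p^-1 by rewrite -conj addrC addKr.
  by rewrite subr_gt0 invf_lt1 // (lt_trans _ p_gt1).
by rewrite invr_gt0.
Qed.

Lemma JN_fineK : (fine (JN_norm p s Q0 f))%:E = JN_norm p s Q0 f.
Proof.
apply: fineK; rewrite ge0_fin_numE //.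
(* The empty family shows that the norm is nonnegative. *)
have := @JN_norm_ge _ _ _ [::] (fun j => D j) isT _ p s Q0 f if_ _.
rewrite big_nil powR0 ?invr_eq0 ?gt_eqF ?(lt_trans _ p_gt1) //.
by apply.
Qed.

Lemma superlevel_fineK t : (fine (leb (superlevel t)))%:E = leb (superlevel t).
Proof.
apply: fineK; rewrite ge0_fin_numE; last exact: (outer_measure_ge0 (@lebesgue_outer R n)).
apply: (@le_lt_trans _ _ (leb Q0)); last by rewrite lebesgue_cube ltry.
by apply: (le_outer_measure (@lebesgue_outer R n)) => x [].
Qed.

(** Combines [good_lambda_cube], with [h] the projection of the deviation on [D j], and
    [oscillation_projection], which trades the polynomial of [Q0] for that of [D j]. *)
Lemma selected_volume_local (r : seq idx) j : uniq r ->
  (forall i, i \in r -> selected A lambda i /\ D i `<=` D j) ->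
  selected A (theta * lambda) j ->
  (1 - 2 ^+ n * theta * C) * lambda * \sum_(i <- r) vol i <=
  (1 + C) * \int[leb]_(x in D j) `|deviation s (D j) f x|.
Proof.
move=> ur rP sj.
have vj : dyadic_valid j by case/and3P : sj.
have ij := integrable_on_sub (open_dyadic_sub (Q := Q0) vj) if_.
have igj := integrable_deviation_dyadic vj.
have sq0 := projection_size s (integrable_on_norm if_).
have sqj := projection_size s (integrable_on_norm ij).
have C0 : 0 <= C by rewrite (le_trans _ C_ge1).
apply: le_trans (oscillation_projection C0 ij (projection_le (Q := D j)) sq0 sqj).
set h := projection s (D j) _.
have hB x : (D j : set _) x -> `|peval h x| <= C * (2 ^+ n * (theta * lambda)).
  move=> xj; have := projection_le igj xj.
  rewrite average_normE // -EFinM lee_fin => /le_trans; apply.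
  by rewrite ler_wpM2l //; exact: selected_average_le.
have := @good_lambda_cube _ _ _ r (fun i => D i) ur _ (D j) g (peval h) lambda _ igj
  (integrable_peval _ _) hB _ _.
rewrite (_ : lambda - _ = (1 - 2 ^+ n * theta * C) * lambda); last by ring.
apply.
- move=> i k x /rP[si _] /rP[sk _]; exact: (selected_disjoint si sk).
- by move=> i /rP[].
move=> i /rP[/and3P[_ /ltW + _] _]; rewrite /A => h1.
by rewrite mulrC -ler_pdivlMl ?vol_gt0.
Qed.

Lemma selected_volume_le (r : seq idx) : uniq r ->
  (forall i, i \in r -> selected A lambda i) ->
  (1 - 2 ^+ n * theta * C) * lambda * \sum_(i <- r) vol i <=
  (1 + C) * (fine (JN_norm p s Q0 f) *
    fine (leb (superlevel (theta * lambda))) `^ p'^-1).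
Proof.
move=> ur rP.
(* [up i] is the maximal cube at threshold [theta * lambda] around [D i]; an index that is not
   selected is sent to itself by default. *)
have [up upP] : {up : idx -> idx & forall i, selected A lambda i ->
    selected A (theta * lambda) (up i) /\ D i `<=` D (up i)}.
  apply: (@choice _ _ (fun i j => selected A lambda i ->
    selected A (theta * lambda) j /\ D i `<=` D j)) => i.
  have [si|_] := boolP (selected A lambda i); last by exists i.
  have /and3P[vi li _] := si.
  have [m mi sm] := selected_ancestor vi (le_lt_trans theta_lambda_le li).
  by exists (ancestor m i) => _; split => //; exact: open_dyadic_ancestor.
pose J := undup (map up r).
have JP j : j \in J -> selected A (theta * lambda) j.
  by rewrite mem_undup => /mapP[i /rP /upP[+ _] ->].
have dJ i j x : i \in J -> j \in J -> (D i : set _) x -> (D j : set _) x -> i = j.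
  by move=> /JP si /JP sj; exact: selected_disjoint si sj.
have JQ i : i \in J -> D i `<=` Q0.
  by move=> /JP /and3P[vi _ _]; exact: open_dyadic_sub.
have uJ : uniq J by exact: undup_uniq.
(* Grouping by [up]: each [i] in [r] meets exactly one [j] of the duplicate-free list [J]. *)
have -> : \sum_(i <- r) vol i = \sum_(j <- J) \sum_(i <- [seq i <- r | up i == j]) vol i.
  under [RHS]eq_bigr do rewrite big_filter.
  rewrite (exchange_big_dep predT) //= big_seq [RHS]big_seq; apply: eq_bigr => i ir.
  rewrite -big_filter (_ : [seq j <- J | up i == j] = [:: up i]) ?big_seq1 //.
  under eq_filter do rewrite eq_sym.
  by apply: filter_pred1_uniq => //; rewrite mem_undup map_f.
(* The mean oscillation in the norm: [vol j * a j] is the integral of the local estimate. *)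
pose a j := (vol j)^-1 * \int[leb]_(x in D j) `|deviation s (D j) f x|.
have a0 j : 0 <= a j.
  by rewrite mulr_ge0 ?invr_ge0 ?(ltW (vol_gt0 j)) // Rintegral_ge0.
apply: (@le_trans _ _ ((1 + C) * \sum_(j <- J) vol j * a j)).
  rewrite !mulr_sumr big_seq [leRHS]big_seq; apply: ler_sum => j jJ.
  rewrite /a mulVKf ?gt_eqF ?vol_gt0 //.
  apply: selected_volume_local; [exact: filter_uniq| |exact: JP].
  by move=> i; rewrite mem_filter => /andP[/eqP <- /rP si]; have [] := upP i si.
rewrite ler_wpM2l ?addr_ge0 ?(le_trans _ C_ge1) //.
have p0 : 0 < p by exact: lt_trans p_gt1.
apply: le_trans (finite_hoelder J p0 dual_gt0 conj (fun j => ltW (vol_gt0 j)) a0) _.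
(* The first Hoelder factor is the norm's expression for the family [J]; the second is a power of
   the total volume of disjoint cubes inside the superlevel set. *)
apply: ler_pM; rewrite ?powR_ge0 //.
  rewrite -lee_fin JN_fineK.
  exact: (@JN_norm_ge _ _ _ J (fun j => D j) uJ dJ p s Q0 f if_ JQ).
rewrite ge0_ler_powR ?nnegrE ?invr_ge0 ?(ltW dual_gt0) //.
- by rewrite sumr_ge0 // => j _; exact: ltW (vol_gt0 j).
- by rewrite fine_ge0 //; exact: (outer_measure_ge0 (@lebesgue_outer R n)).
rewrite -lee_fin superlevel_fineK.
apply: (sum_volume_cubes uJ dJ) => i /JP /and3P[vi ti _].
exact: dyadic_sub_superlevel.
Qed.

(** The closed selected cubes cover the set; countable subadditivity leaves finite partial sums,
    each bounded by [K]. *)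
Lemma superlevel_le (K : R) :
  (forall r : seq idx, uniq r -> (forall i, i \in r -> selected A lambda i) ->
    \sum_(i <- r) vol i <= K) ->
  (leb (superlevel lambda) <= K%:E)%E.
Proof.
move=> hK.
(* [pickle_inv] returns [i] only on the code of [i], so no cube is repeated in a partial sum. *)
pose F k : set 'rV[R]_n := if pickle_inv k is Some i then
  if selected A lambda i then closure_cube (D i) : set _ else set0 else set0.
have cov : superlevel lambda `<=` \bigcup_k F k.
  move=> x /superlevel_cover[i si xi]; exists (pickle i) => //.
  by rewrite /F pickleK_inv si.
apply: le_trans (le_outer_measure (@lebesgue_outer R n) _ _ cov) _.
apply: le_trans (outer_measure_sigma_subadditive (@lebesgue_outer R n) F) _.
apply: lime_le.
  by apply: is_cvg_nneseries => k _ _; exact: (outer_measure_ge0 (@lebesgue_outer R n)).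
apply: nearW => m.
pose r := [seq i <- pmap (@pickle_inv idx) (index_iota 0 m) | selected A lambda i].
have ur : uniq r.
  by apply: filter_uniq; apply: (pmap_uniq (@pickle_invK idx)); exact: iota_uniq.
have := hK r ur (fun i => _); rewrite /r.
rewrite (_ : (\sum_(0 <= k < m) _)%E = (\sum_(i <- r) vol i)%:E).
  by rewrite lee_fin; apply => i; rewrite mem_filter => /andP[].
rewrite /r big_filter [in RHS]big_mkcond big_pmap -sumEFin; apply: eq_bigr => k _.
rewrite /F; case: pickle_inv => [i|] /=; last exact: outer_measure0.
case: ifP => _; last exact: outer_measure0.
exact: (lebesgue_cube (closure_cube (D i))).
Qed.

End Constants.
End GoodLambda.

(** * Good-lambda inequality for the dyadic maximal operator *)

Unset Implicit Arguments.
Set Strict Implicit.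

Theorem lemma4p3 (R : realType) (n s : nat) (p p' C theta : R)
    (Q0 : cube R n) (f : 'rV[R]_n -> R) :
  (0 < n)%N -> 1 < p -> p^-1 + p'^-1 = 1 -> 1 <= C ->
  (forall (Q : cube R n) (g : 'rV[R]_n -> R), integrable_on Q g ->
     forall x : 'rV[R]_n, (Q : set _) x ->
     (`|peval (projection s Q g) x|%:E <= C%:E * average Q (fun y => `|g y|)%R)%E) ->
  0 < theta -> theta < (2 ^+ n)^-1 * C^-1 ->
  in_JN p s Q0 f ->
  forall lambda : R, 0 < lambda ->
  ((theta^-1)%:E * average Q0 (fun x => `|deviation s Q0 f x|)%R <= lambda%:E)%E ->
  (lebesgue_rV [set x | (Q0 : set _) x /\
       lambda%:E < dyadic_maximal Q0 (deviation s Q0 f) x]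
   <= ((1 + C) / (1 - 2 ^+ n * theta * C))%:E
      * (JN_norm p s Q0 f * (lambda^-1)%:E)
      * lebesgue_rV [set x | (Q0 : set _) x /\
          (theta * lambda)%:E < dyadic_maximal Q0 (deviation s Q0 f) x] `^ p'^-1)%E.

Proof.
move=> _ p1 pp C1 hC t0 tlt [if_ JNfin] lambda l0.
have C0 : 0 < 1 + C by rewrite ltr_wpDr // (le_trans _ C1).
rewrite (average_root s if_) -EFinM lee_fin ler_pdivrMl // => root_le.
have k0 := kappa_gt0 C1 tlt.
have JN0 := JN_fineK if_ p1 JNfin.
have WK := superlevel_fineK s Q0 f (theta * lambda).
(* The norm and the measure on the right are finite, so the bound is a real number and
   [superlevel_le] applies. *)
rewrite -[X in (_ * X `^ _)%E]WK -JN0 poweR_EFin -!EFinM.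
apply: superlevel_le => // r ur rP.
have := selected_volume_le if_ p1 pp C1 hC tlt JNfin l0 root_le ur rP.
set N := fine _; set W := fine _ `^ _; set V := \sum_(i <- r) _ => h.
(* Multiplication by the positive number [(1 - 2 ^+ n * theta * C) * lambda] clears the
   denominators. *)
rewrite -(ler_pM2l (mulr_gt0 k0 l0)); apply: le_trans h _.
rewrite le_eqVlt; apply/orP; left; apply/eqP; field.
by rewrite !gt_eqF.
Qed.
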